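(* Let $\mathbb{C}$ be a regular category and let $X$ be any object of $\mathbb{C}$ with global support. Then $X$ has factorable congruences if and only if $X$ is regularly-coextensive.
   Context: A category is regular if it has finite limits, coequalizers of kernel pairs, and regular epimorphisms are stable under pullback. $X$ has global support if $X\to 1$ is a regular epimorphism. A product projection of $X$ is a morphism $X\to A$ that is one of the two legs of some binary product diagram $A\leftarrow X\to A'$. An equivalence relation is effective if it is represented by the kernel pair of some morphism. Given a product diagram $A\xleftarrow{\pi_1}X\xrightarrow{\pi_2}B$ and effective equivalence relations $E$ on $A$ and $F$ on $B$, represented by $e:E_0\to A^2$ and $f:F_0\to B^2$, the composite $E_0\times F_0\xrightarrow{e\times f}A^2\times B^2\cong X^2$ (canonical isomorphism) represents an effective equivalence relation on $X$ denoted $E\times F$. $X$ has factorable congruences if for any effective equivalence relation $E$ on $X$ and any product diagram $A\xleftarrow{\pi_1}X\xrightarrow{\pi_2}B$ there exist effective equivalence relations $E_1$ on $A$ and $E_2$ on $B$ with $E_1\times E_2=E$. For a class $\mathcal{M}$ of morphisms, an $\mathcal{M}$-pushout is a pushout square whose two morphisms into the pushout object belong to $\mathcal{M}$. $X$ is $\mathcal{M}$-coextensive if every morphism in $\mathcal{M}$ with domain $X$ admits an $\mathcal{M}$-pushout along every product projection of $X$, and for every commutative diagram consisting of a product diagram $A_1\leftarrow X\to A_2$ (top row), a bottom row $B_1\leftarrow Y\to B_2$, and vertical morphisms $A_1\to B_1$, $X\to Y$, $A_2\to B_2$ all in $\mathcal{M}$, the bottom row is a product diagram if and only if both squares are $\mathcal{M}$-pushouts.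 $X$ is regularly-coextensive if it is $\mathcal{M}$-coextensive with $\mathcal{M}$ the class of all regular epimorphisms. *)

(* Defs.v *)
From Stdlib Require Import List.

Set Implicit Arguments.
Unset Strict Implicit.
Unset Printing Implicit Defensive.

Record category : Type := Category {
  ob :> Type;
  hom : ob -> ob -> Type;
  idm : forall A : ob, hom A A;
  comp : forall A B D : ob, hom B D -> hom A B -> hom A D;
  comp_idl : forall (A B : ob) (f : hom A B), comp (idm B) f = f;
  comp_idr : forall (A B : ob) (f : hom A B), comp f (idm A) = f;
  compA : forall (A B D E : ob) (h : hom D E) (g : hom B D) (f : hom A B),
    comp h (comp g f) = comp (comp h g) f
}.

Arguments hom {c} A B.
Arguments idm {c} A.
Arguments comp {c A B D} g f.

Declare Scope cat_scope.
Delimit Scope cat_scope with cat.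
Open Scope cat_scope.
Notation "g \o f" := (comp g f) (at level 40, left associativity) : cat_scope.

Record functor (J C : category) : Type := Functor {
  fob :> J -> C;
  fmap : forall i j : J, hom i j -> hom (fob i) (fob j);
  fmap_id : forall i : J, fmap (idm i) = idm (fob i);
  fmap_comp : forall (i j k : J) (g : hom j k) (f : hom i j),
    fmap (g \o f) = fmap g \o fmap f
}.

Arguments fmap {J C} f {i j} _ : rename.

Definition finite_type (T : Type) : Prop :=
  exists s : list T, forall x : T, In x s.

Definition finite_category (J : category) : Prop :=
  finite_type J /\ forall i j : J, finite_type (hom i j).

Definition is_cone (J C : category) (F : functor J C) (L : C)
    (l : forall i : J, hom L (F i)) : Prop :=
  forall (i j : J) (u : hom i j), fmap F u \o l i = l j.

Definition is_limit (J C : category) (F : functor J C) (L : C)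
    (l : forall i : J, hom L (F i)) : Prop :=
  is_cone l /\
  forall (T : C) (t : forall i : J, hom T (F i)), is_cone t ->
    exists! h : hom T L, forall i : J, l i \o h = t i.

Definition has_finite_limits (C : category) : Prop :=
  forall (J : category) (F : functor J C), finite_category J ->
    exists (L : C) (l : forall i : J, hom L (F i)), is_limit l.

Section Basic.
Context {C : category}.

Definition is_mono (A B : C) (m : hom A B) : Prop :=
  forall (T : C) (u v : hom T A), m \o u = m \o v -> u = v.

Definition is_iso (A B : C) (f : hom A B) : Prop :=
  exists g : hom B A, g \o f = idm A /\ f \o g = idm B.

Definition is_terminal (T : C) : Prop :=
  forall A : C, exists! t : hom A T, True.

Definition is_product (A X B : C) (p1 : hom X A) (p2 : hom X B) : Prop :=
  forall (T : C) (a : hom T A) (b : hom T B),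
    exists! h : hom T X, p1 \o h = a /\ p2 \o h = b.

Definition is_pullback (P A B D : C) (p : hom P A) (q : hom P B)
    (f : hom A D) (g : hom B D) : Prop :=
  f \o p = g \o q /\
  forall (T : C) (a : hom T A) (b : hom T B), f \o a = g \o b ->
    exists! h : hom T P, p \o h = a /\ q \o h = b.

Definition is_pushout (D A B P : C) (f : hom D A) (g : hom D B)
    (u : hom A P) (v : hom B P) : Prop :=
  u \o f = v \o g /\
  forall (T : C) (a : hom A T) (b : hom B T), a \o f = b \o g ->
    exists! h : hom P T, h \o u = a /\ h \o v = b.

Definition is_kernel_pair (K A B : C) (k1 k2 : hom K A) (f : hom A B) : Prop :=
  is_pullback k1 k2 f f.

Definition is_coequalizer (Z A Q : C) (u v : hom Z A) (q : hom A Q) : Prop :=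
  q \o u = q \o v /\
  forall (T : C) (t : hom A T), t \o u = t \o v -> exists! h : hom Q T, h \o q = t.

Definition regular_epi (A B : C) (f : hom A B) : Prop :=
  exists (Z : C) (u v : hom Z A), is_coequalizer u v f.

Definition global_support (X : C) : Prop :=
  exists (T : C) (t : hom X T), is_terminal T /\ regular_epi t.

Definition is_product_projection (X A : C) (p : hom X A) : Prop :=
  exists (A' : C) (p' : hom X A'), is_product p p'.

(* A representative of a relation on A. Products are not chosen in C, so a
   representative carries the product diagram presenting A^2. *)
Record relation (A : C) : Type := Relation {
  rel_ob : C;
  rel_sq : C;
  sq1 : hom rel_sq A;
  sq2 : hom rel_sq A;
  sq_product : is_product sq1 sq2;
  rel_mor : hom rel_ob rel_sq;
  rel_mono : is_mono rel_mor
}.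

(* The pair (a, b) of generalized elements of A lies in the relation E. *)
Definition related (A : C) (E : relation A) (T : C) (a b : hom T A) : Prop :=
  exists h : hom T (rel_ob E),
    sq1 E \o rel_mor E \o h = a /\ sq2 E \o rel_mor E \o h = b.

Definition is_equivalence (A : C) (E : relation A) : Prop :=
  forall T : C,
    (forall a : hom T A, related E a a) /\
    (forall a b : hom T A, related E a b -> related E b a) /\
    (forall a b c : hom T A, related E a b -> related E b c -> related E a c).

Definition effective_equivalence (A : C) (E : relation A) : Prop :=
  is_equivalence E /\
  exists (Q : C) (q : hom A Q),
    is_kernel_pair (sq1 E \o rel_mor E) (sq2 E \o rel_mor E) q.

Definition same_subobject (S T Y : C) (m : hom S Y) (n : hom T Y) : Prop :=
  exists i : hom S T, is_iso i /\ n \o i = m.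

(* m is e x f, with respect to given product diagrams on domain and codomain. *)
Definition is_product_map (A B A' B' P P' : C) (p1 : hom P A) (p2 : hom P B)
    (p1' : hom P' A') (p2' : hom P' B') (e : hom A A') (f : hom B B')
    (m : hom P P') : Prop :=
  p1' \o m = e \o p1 /\ p2' \o m = f \o p2.

(* c is the canonical isomorphism W = A^2 x B^2 -> X^2, which sends
   ((a, a'), (b, b')) to ((a, b), (a', b')). *)
Definition is_canonical_iso (A X B : C) (pi1 : hom X A) (pi2 : hom X B)
    (A2 B2 X2 W : C) (a1 a2 : hom A2 A) (b1 b2 : hom B2 B) (x1 x2 : hom X2 X)
    (w1 : hom W A2) (w2 : hom W B2) (c : hom W X2) : Prop :=
  is_iso c /\
  pi1 \o x1 \o c = a1 \o w1 /\ pi2 \o x1 \o c = b1 \o w2 /\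
  pi1 \o x2 \o c = a2 \o w1 /\ pi2 \o x2 \o c = b2 \o w2.

(* E x F = G as relations on X, along the product diagram A <- X -> B. The
   subobject represented by c \o m does not depend on the choice of the products
   P = E_0 x F_0 and W = A^2 x B^2. *)
Definition product_relation_eq (A X B : C) (pi1 : hom X A) (pi2 : hom X B)
    (E : relation A) (F : relation B) (G : relation X) : Prop :=
  exists (P : C) (p1 : hom P (rel_ob E)) (p2 : hom P (rel_ob F))
         (W : C) (w1 : hom W (rel_sq E)) (w2 : hom W (rel_sq F))
         (m : hom P W) (c : hom W (rel_sq G)),
    is_product p1 p2 /\ is_product w1 w2 /\
    is_product_map p1 p2 w1 w2 (rel_mor E) (rel_mor F) m /\
    is_canonical_iso pi1 pi2 (sq1 E) (sq2 E) (sq1 F) (sq2 F) (sq1 G) (sq2 G)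
      w1 w2 c /\
    same_subobject (c \o m) (rel_mor G).

Definition factorable_congruences (X : C) : Prop :=
  forall E : relation X, effective_equivalence E ->
  forall (A B : C) (pi1 : hom X A) (pi2 : hom X B), is_product pi1 pi2 ->
    exists (E1 : relation A) (E2 : relation B),
      effective_equivalence E1 /\ effective_equivalence E2 /\
      product_relation_eq pi1 pi2 E1 E2 E.

Definition morphism_class : Type := forall A B : C, hom A B -> Prop.

Definition M_pushout (M : morphism_class) (D A B P : C) (f : hom D A)
    (g : hom D B) (u : hom A P) (v : hom B P) : Prop :=
  is_pushout f g u v /\ M A P u /\ M B P v.

Definition M_coextensive (M : morphism_class) (X : C) : Prop :=
  (forall (Y : C) (f : hom X Y), M X Y f ->
   forall (A : C) (p : hom X A), is_product_projection p ->
     exists (P : C) (u : hom A P) (v : hom Y P), M_pushout M p f u v) /\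
  (forall (A1 A2 : C) (p1 : hom X A1) (p2 : hom X A2),
   forall (B1 Y B2 : C) (q1 : hom Y B1) (q2 : hom Y B2),
   forall (g1 : hom A1 B1) (f : hom X Y) (g2 : hom A2 B2),
     is_product p1 p2 ->
     M A1 B1 g1 -> M X Y f -> M A2 B2 g2 ->
     g1 \o p1 = q1 \o f -> g2 \o p2 = q2 \o f ->
     (is_product q1 q2 <->
      M_pushout M p1 f g1 q1 /\ M_pushout M p2 f g2 q2)).

Definition regularly_coextensive (X : C) : Prop :=
  M_coextensive (@regular_epi) X.

End Basic.

Definition regular_category (C : category) : Prop :=
  has_finite_limits C /\
  (forall (K A B : C) (k1 k2 : hom K A) (f : hom A B), is_kernel_pair k1 k2 f ->
     exists (Q : C) (q : hom A Q), is_coequalizer k1 k2 q) /\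
  (forall (P A B D : C) (p : hom P A) (q : hom P B) (f : hom A D) (g : hom B D),
     is_pullback p q f g -> regular_epi g -> regular_epi p).

(* Main.v *)
From Corelib Require Import ssreflect.
From Stdlib Require Import List.
Require Import Defs.

(** Everything is computed with generalized elements.  An effective equivalence
    relation is the relation [q a = q b] of a regular epimorphism [q], and a
    regular epimorphism is determined up to isomorphism by this relation.
    Hence factorability says that every regular epimorphism [f : X -> Y] is
    isomorphic to [q1 x q2] for regular epimorphisms [q1], [q2] out of the two
    factors of [X].  Since [X] has global support, its product projections are
    regular epimorphisms, and this makes the squares from [f] to [q1] and [q2]
    pushouts.  As pushouts are unique, the decomposition of [Y] as a product is
    the one given by the pushouts of [f] along the projections of [X]. *)

Set Implicit Arguments.
Unset Strict Implicit.
Unset Printing Implicit Defensive.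

Lemma ex_unique_eq (T : Type) (P : T -> Prop) (x y : T) :
  (exists! z, P z) -> P x -> P y -> x = y.
Proof. by move=> [z [_ huniq]] hx hy; rewrite -(huniq x) // (huniq y). Qed.

(** * Regular epimorphisms, monomorphisms and pushouts in an arbitrary category *)

Section Morphisms.
Context {C : category}.

(** Once composites associate to the right, [g \o f] occurs only with a further arrow behind it;
    this form of the equation still rewrites there. *)
Lemma comp_reassoc (A B D T : C) (g : hom B D) (f : hom A B) (h : hom A D) :
  g \o f = h -> forall x : hom T A, g \o (f \o x) = h \o x.
Proof. by move=> <- x; rewrite compA. Qed.

Lemma comp_reassoc2 (A B B' D T : C) (g : hom B D) (f : hom A B)
    (h : hom B' D) (k : hom A B') :
  g \o f = h \o k -> forall x : hom T A, g \o (f \o x) = h \o (k \o x).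
Proof. by move=> e x; rewrite !compA e. Qed.

Definition is_epi (A B : C) (f : hom A B) : Prop :=
  forall (T : C) (u v : hom B T), u \o f = v \o f -> u = v.

Lemma mono_split_epi_iso (A B : C) (m : hom A B) (s : hom B A) :
  is_mono m -> m \o s = idm B -> is_iso m.
Proof.
move=> hm e; exists s; split=> //; apply: hm.
by rewrite compA e comp_idl comp_idr.
Qed.

Lemma regular_epi_epi (A B : C) (f : hom A B) : regular_epi f -> is_epi f.
Proof.
move=> [Z [u [v [e hf]]]] T a b eab.
have e' : (a \o f) \o u = (a \o f) \o v by rewrite -!compA e.
by apply: (ex_unique_eq (hf _ _ e')).
Qed.

(** The hypothesis is applied to the parallel pair that [f] coequalizes. Quantifying over all
    generalized elements avoids choosing a kernel pair. *)
Lemma regular_epi_factor (A B D : C) (f : hom A B) (a : hom A D) :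
  regular_epi f ->
  (forall (T : C) (x y : hom T A), f \o x = f \o y -> a \o x = a \o y) ->
  exists h : hom B D, h \o f = a.
Proof.
move=> [Z [u [v [e hf]]]] H.
by have [h [eh _]] := hf _ a (H _ _ _ e); exists h.
Qed.

(** Since [m] is monic, [g] identifies all that [f] identifies and so factors as [s \o f];
    cancelling [f] shows that [s] is a section of [m]. *)
Lemma regular_epi_strong (A B D : C) (f : hom A B) (g : hom A D) (m : hom D B) :
  regular_epi f -> is_mono m -> m \o g = f -> is_iso m.
Proof.
move=> hf hm e.
have [|s es] := @regular_epi_factor _ _ _ f g hf.
  by move=> T x y exy; apply: hm; rewrite !compA e.
apply: (mono_split_epi_iso (s := s)) => //.
by apply: (regular_epi_epi hf); rewrite -compA es e comp_idl.
Qed.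

Lemma regular_epi_iso_l (A B D : C) (f : hom A B) (w : hom B D) :
  is_iso w -> regular_epi f -> regular_epi (w \o f).
Proof.
move=> [w' [ew' ew]] [Z [u [v [e hf]]]]; exists Z, u, v; split.
  by rewrite -!compA e.
move=> T t et; have [h [eh huniq]] := hf _ _ et.
exists (h \o w'); split.
  by rewrite -!compA (comp_reassoc ew') comp_idl.
by move=> k ek; rewrite (huniq (k \o w)) -?compA // ew comp_idr.
Qed.

(** Each map factors through the other, and the two factors are mutually inverse because both maps
    are epic. *)
Lemma regular_epi_same_kernel_iso (A B D : C) (f : hom A B) (g : hom A D) :
  regular_epi f -> regular_epi g ->
  (forall (T : C) (x y : hom T A), f \o x = f \o y <-> g \o x = g \o y) ->
  exists w : hom B D, is_iso w /\ w \o f = g.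
Proof.
move=> hf hg H.
have [|w ew] := @regular_epi_factor _ _ _ f g hf; first by move=> T x y /H.
have [|z ez] := @regular_epi_factor _ _ _ g f hg; first by move=> T x y /H.
exists w; split=> //; exists z; split.
  by apply: (regular_epi_epi hf); rewrite -compA ew ez comp_idl.
by apply: (regular_epi_epi hg); rewrite -compA ez ew comp_idl.
Qed.

Lemma pushout_unique (D A B P P' : C) (f : hom D A) (g : hom D B)
    (u : hom A P) (v : hom B P) (u' : hom A P') (v' : hom B P') :
  is_pushout f g u v -> is_pushout f g u' v' ->
  exists w : hom P P', is_iso w /\ w \o u = u' /\ w \o v = v'.
Proof.
move=> [e h] [e' h'].
have [w [[wu wv] _]] := h _ _ _ e'.
have [z [[zu zv] _]] := h' _ _ _ e.
exists w; split=> //; exists z; split.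
  by apply: (ex_unique_eq (h _ _ _ e)); rewrite ?comp_idl // -!compA wu wv.
by apply: (ex_unique_eq (h' _ _ _ e')); rewrite ?comp_idl // -!compA zu zv.
Qed.

End Morphisms.

(** * Binary products and the canonical isomorphism onto the square of a product *)

Section Products.
Context {C : category}.

Lemma product_lift (A X B T : C) (p1 : hom X A) (p2 : hom X B) :
  is_product p1 p2 -> forall (a : hom T A) (b : hom T B),
  exists h : hom T X, p1 \o h = a /\ p2 \o h = b.
Proof. by move=> hp a b; have [h [eh _]] := hp T a b; exists h. Qed.

Lemma product_ext (A X B T : C) (p1 : hom X A) (p2 : hom X B) (u v : hom T X) :
  is_product p1 p2 -> p1 \o u = p1 \o v -> p2 \o u = p2 \o v -> u = v.
Proof.
by move=> hp e1 e2; apply: (ex_unique_eq (hp T (p1 \o v) (p2 \o v))).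
Qed.

Lemma product_sym (A X B : C) (p1 : hom X A) (p2 : hom X B) :
  is_product p1 p2 -> is_product p2 p1.
Proof.
move=> hp T b a; have [h [[e1 e2] huniq]] := hp T a b.
by exists h; split=> // k [k1 k2]; apply: huniq.
Qed.

Lemma product_iso_apex (A X Y B : C) (p1 : hom X A) (p2 : hom X B)
    (w : hom Y X) :
  is_product p1 p2 -> is_iso w -> is_product (p1 \o w) (p2 \o w).
Proof.
move=> hp [z [zw wz]] T a b.
have [h [e1 e2]] := product_lift hp a b.
exists (z \o h); split.
  by rewrite -!compA (comp_reassoc wz) comp_idl.
move=> k []; rewrite -!compA => k1 k2.
have -> : h = w \o k by apply: (product_ext hp); rewrite ?e1 ?e2.
by rewrite (comp_reassoc zw) comp_idl.
Qed.

Lemma product_iso_factors (A A' X B B' : C) (p1 : hom X A) (p2 : hom X B)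
    (w1 : hom A A') (w2 : hom B B') :
  is_product p1 p2 -> is_iso w1 -> is_iso w2 ->
  is_product (w1 \o p1) (w2 \o p2).
Proof.
move=> hp [z1 [zw1 wz1]] [z2 [zw2 wz2]] T a b.
have [h [e1 e2]] := product_lift hp (z1 \o a) (z2 \o b).
exists h; split.
  by rewrite -!compA e1 e2 (comp_reassoc wz1) (comp_reassoc wz2) !comp_idl.
move=> k [k1 k2]; apply: (product_ext hp).
  by rewrite e1 -k1 -compA (comp_reassoc zw1) comp_idl.
by rewrite e2 -k2 -compA (comp_reassoc zw2) comp_idl.
Qed.

Lemma product_map_mono (A B A' B' P P' : C) (p1 : hom P A) (p2 : hom P B)
    (p1' : hom P' A') (p2' : hom P' B') (e : hom A A') (f : hom B B')
    (m : hom P P') :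
  is_product p1 p2 -> is_product_map p1 p2 p1' p2' e f m ->
  is_mono e -> is_mono f -> is_mono m.
Proof.
move=> hp [m1 m2] he hf T u v euv; apply: (product_ext hp).
  by apply: he; rewrite !compA -m1 -!compA euv.
by apply: hf; rewrite !compA -m2 -!compA euv.
Qed.

Lemma canonical_iso_exists (A X B : C) (pi1 : hom X A) (pi2 : hom X B)
    (A2 B2 X2 W : C) (a1 a2 : hom A2 A) (b1 b2 : hom B2 B) (x1 x2 : hom X2 X)
    (w1 : hom W A2) (w2 : hom W B2) :
  is_product pi1 pi2 -> is_product a1 a2 -> is_product b1 b2 ->
  is_product x1 x2 -> is_product w1 w2 ->
  exists c : hom W X2, is_canonical_iso pi1 pi2 a1 a2 b1 b2 x1 x2 w1 w2 c.
Proof.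
move=> hpi ha hb hx hw.
have [y1 [y11 y12]] := product_lift hpi (a1 \o w1) (b1 \o w2).
have [y2 [y21 y22]] := product_lift hpi (a2 \o w1) (b2 \o w2).
have [c [c1 c2]] := product_lift hx y1 y2.
(* The inverse regroups [(x, x')] as [((pi1 x, pi1 x'), (pi2 x, pi2 x'))]. *)
have [za [za1 za2]] := product_lift ha (pi1 \o x1) (pi1 \o x2).
have [zb [zb1 zb2]] := product_lift hb (pi2 \o x1) (pi2 \o x2).
have [z [z1 z2]] := product_lift hw za zb.
exists c; split; last by rewrite -!compA c1 c2.
exists z; split.
  apply: (product_ext hw); [apply: (product_ext ha)|apply: (product_ext hb)];
    rewrite comp_idr ?(comp_reassoc z1) ?(comp_reassoc z2)
            ?(comp_reassoc2 za1) ?(comp_reassoc2 za2)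
            ?(comp_reassoc2 zb1) ?(comp_reassoc2 zb2) ?c1 ?c2 //.
apply: (product_ext hx); apply: (product_ext hpi);
  rewrite comp_idr ?(comp_reassoc c1) ?(comp_reassoc c2)
    ?(comp_reassoc2 y11) ?(comp_reassoc2 y12)
    ?(comp_reassoc2 y21) ?(comp_reassoc2 y22) ?z1 ?z2 //.
Qed.

End Products.

(** * Terminal objects, pullbacks and products from finite limits *)

Section FiniteLimits.
Context {C : category}.

Definition empty_category : category.
Proof.
by unshelve refine (@Category Empty_set (fun _ _ => unit) _ _ _ _ _); case.
Defined.

Definition empty_functor : functor empty_category C.
Proof. by unshelve refine (@Functor empty_category C _ _ _ _); case. Defined.

Lemma terminal_exists : has_finite_limits C -> exists T : C, is_terminal T.
Proof.
move=> hC.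
have [|L [l [_ hL]]] := hC empty_category empty_functor.
  by split; [exists nil; case|case].
exists L => A.
have [|h [_ huniq]] := hL A (fun i : empty_category => match i with end).
  by case.
by exists h; split=> // k _; apply: huniq; case.
Qed.

Inductive cospan_ob : Type := CospanL | CospanR | CospanD.

(** The shape [L -> D <- R]. Homs are computed by matching and have at most one element, so case
    analysis settles finiteness and the category laws. *)
Definition cospan_hom (i j : cospan_ob) : Type :=
  match i, j with
  | CospanL, CospanL | CospanR, CospanR | CospanD, CospanD
  | CospanL, CospanD | CospanR, CospanD => unit
  | _, _ => Empty_set
  end.

Definition cospan_id (i : cospan_ob) : cospan_hom i i :=
  match i with CospanL | CospanR | CospanD => tt end.

Definition cospan_comp (i j k : cospan_ob) :
  cospan_hom j k -> cospan_hom i j -> cospan_hom i k.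
Proof. by case: i; case: j; case: k => //= -[] // -[]. Defined.

Definition cospan_category : category.
Proof.
by refine (@Category cospan_ob cospan_hom cospan_id cospan_comp _ _ _);
  do ?[case].
Defined.

Lemma cospan_category_finite : finite_category cospan_category.
Proof.
split; first by exists (CospanL :: CospanR :: CospanD :: nil); case=> /=; tauto.
by case; case; (exists (tt :: nil) || exists nil); case; left.
Qed.

Section CospanDiagram.
Context {A B D : C} (f : hom A D) (g : hom B D).

Definition cospan_fob (i : cospan_ob) : C :=
  match i with CospanL => A | CospanR => B | CospanD => D end.

Definition cospan_fmap (i j : cospan_ob) :
    cospan_hom i j -> hom (cospan_fob i) (cospan_fob j) :=
  match i, j return cospan_hom i j -> hom (cospan_fob i) (cospan_fob j) with
  | CospanL, CospanD => fun _ => f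
  | CospanR, CospanD => fun _ => g
  | CospanL, CospanL => fun _ => idm A
  | CospanR, CospanR => fun _ => idm B
  | CospanD, CospanD => fun _ => idm D
  | _, _ => fun u => match u with end
  end.

Definition cospan_diagram : functor cospan_category C.
Proof.
refine (@Functor cospan_category C cospan_fob cospan_fmap _ _); first by case.
by case; case; case=> -[] -[]; rewrite /= ?comp_idl ?comp_idr.
Defined.

Definition cospan_legs (T : C) (a : hom T A) (b : hom T B) (d : hom T D)
    (i : cospan_ob) : hom T (cospan_fob i) :=
  match i with CospanL => a | CospanR => b | CospanD => d end.

Lemma pullback_exists :
  has_finite_limits C ->
  exists (P : C) (p : hom P A) (q : hom P B), is_pullback p q f g.
Proof.
move=> hC.
have [P [l [hl hP]]] := hC _ cospan_diagram cospan_category_finite.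
have eL : f \o l CospanL = l CospanD by apply: (hl CospanL CospanD tt).
have eR : g \o l CospanR = l CospanD by apply: (hl CospanR CospanD tt).
exists P, (l CospanL), (l CospanR); split; first by rewrite eL eR.
move=> T a b eab.
have [|h [eh huniq]] := hP T (cospan_legs a b (f \o a)).
  by case; case=> -[] /=; rewrite ?comp_idl.
exists h; split; first by split; [apply: (eh CospanL)|apply: (eh CospanR)].
move=> k [k1 k2]; apply: huniq; case=> //=.
by rewrite -eL -compA k1.
Qed.

End CospanDiagram.

(** The pullback over a terminal object serves: any two arrows into that object agree, so the
    commutation condition is automatic. *)
Lemma product_exists (A B : C) :
  has_finite_limits C ->
  exists (P : C) (p : hom P A) (q : hom P B), is_product p q.
Proof.
move=> hC; have [T hT] := terminal_exists hC.
have [a _] := hT A; have [b _] := hT B.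
have [P [p [q [_ hP]]]] := pullback_exists a b hC.
exists P, p, q => S u v; apply: hP.
exact: (ex_unique_eq (hT S)).
Qed.

End FiniteLimits.

(** * Covers, images and products of regular epimorphisms in a regular category *)

Section RegularCategory.
Context {C : category} (hC : regular_category C).

(** Regular epimorphisms act as surjections on generalized elements, up to a cover [r] of the
    domain: [r] is the pullback of [g] along [x]. *)
Lemma regular_epi_local_lift (A D T : C) (g : hom A D) (x : hom T D) :
  regular_epi g ->
  exists (S : C) (r : hom S T) (s : hom S A), regular_epi r /\ g \o s = x \o r.
Proof.
move=> hg; have [hlim [_ hstab]] := hC.
have [S [r [s hS]]] := pullback_exists x g hlim.
by exists S, r, s; split; [apply: hstab hS hg|case: hS].
Qed.

Lemma kernel_quotient_mono (A Q B : C) (q : hom A Q) (m : hom Q B) :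
  regular_epi q ->
  (forall (T : C) (x y : hom T A),
    m \o q \o x = m \o q \o y -> q \o x = q \o y) ->
  is_mono m.
Proof.
move=> hq H T u v euv.
have [T1 [r1 [s1 [hr1 e1]]]] := regular_epi_local_lift u hq.
(* The second cover refines the first, so that [u] and [v] both lift to [A] over the common domain
   [T2]. *)
have [T2 [r2 [s2 [hr2 e2]]]] := regular_epi_local_lift (v \o r1) hq.
apply: (regular_epi_epi hr1); apply: (regular_epi_epi hr2).
rewrite -e2 -e1 -compA; apply: H.
by rewrite -!compA (comp_reassoc e1) e2 !compA euv.
Qed.

(** Take for [q] the coequalizer of the kernel pair of [f]; every pair that [f] identifies factors
    through this kernel pair. *)
Lemma kernel_quotient (A B : C) (f : hom A B) :
  exists (Q : C) (q : hom A Q) (m : hom Q B),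
    regular_epi q /\ m \o q = f /\
    forall (T : C) (x y : hom T A), f \o x = f \o y -> q \o x = q \o y.
Proof.
have [hlim [hcoeq _]] := hC.
have [K [k1 [k2 hK]]] := pullback_exists f f hlim.
have [Q [q hq]] := hcoeq _ _ _ _ _ _ hK.
have [eq_k hfac] := hq; have [m [em _]] := hfac _ f (proj1 hK).
exists Q, q, m; split; first by exists K, k1, k2.
split=> // T x y exy.
have [h [[<- <-] _]] := proj2 hK _ _ _ exy.
by rewrite !compA eq_k.
Qed.

Lemma image_factorization (A B : C) (f : hom A B) :
  exists (Q : C) (q : hom A Q) (m : hom Q B),
    regular_epi q /\ is_mono m /\ m \o q = f.
Proof.
have [Q [q [m [hq [em hker]]]]] := kernel_quotient f.
exists Q, q, m; split=> //; split=> //.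
by apply: (kernel_quotient_mono hq) => T x y; rewrite em; apply: hker.
Qed.

(** In the image factorization of [g \o f], the map [q] factors as [h \o f]. Then [m \o h = g], and
    a regular epimorphism through the mono [m] forces [m] to be invertible. *)
Lemma regular_epi_comp (A B D : C) (f : hom A B) (g : hom B D) :
  regular_epi f -> regular_epi g -> regular_epi (g \o f).
Proof.
move=> hf hg; have [Q [q [m [hq [hm e]]]]] := image_factorization (g \o f).
have [|h eh] := @regular_epi_factor _ _ _ _ f q hf.
  by move=> T x y exy; apply: hm; rewrite !compA e -!compA exy.
rewrite -e; apply: regular_epi_iso_l => //.
apply: (regular_epi_strong (g := h) hg hm).
by apply: (regular_epi_epi hf); rewrite -compA eh e.
Qed.

Lemma regular_epi_cancel (A B D : C) (f : hom A B) (g : hom B D) :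
  regular_epi (g \o f) -> regular_epi g.
Proof.
move=> hgf; have [Q [q [m [hq [hm e]]]]] := image_factorization g.
rewrite -e; apply: regular_epi_iso_l => //.
by apply: (regular_epi_strong (g := q \o f) hgf hm); rewrite compA e.
Qed.

(** The square formed by [m], [e] and the first projections is a pullback, so stability applies. *)
Lemma product_map_regular_epi_l (A A' B P P' : C) (p1 : hom P A) (p2 : hom P B)
    (p1' : hom P' A') (p2' : hom P' B) (e : hom A A') (m : hom P P') :
  is_product p1 p2 -> is_product p1' p2' ->
  p1' \o m = e \o p1 -> p2' \o m = p2 -> regular_epi e -> regular_epi m.
Proof.
move=> hp hp' e1 e2; have [_ [_ hstab]] := hC; apply: (hstab _ _ _ _ _ p1 p1').
split=> // T a b eab; have [h [h1 h2]] := product_lift hp b (p2' \o a).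
exists h; split.
  split=> //; apply: (product_ext hp').
    by rewrite (comp_reassoc2 e1) h1 eab.
  by rewrite (comp_reassoc e2).
move=> k [k1 k2]; apply: (product_ext hp); first by rewrite h1 k2.
by rewrite h2 -k1 (comp_reassoc e2).
Qed.

(** [m] is [e x 1] followed by [1 x f], through [W = A' x B]; each of these changes one component
    only. *)
Lemma product_map_regular_epi (A B A' B' P P' : C) (p1 : hom P A)
    (p2 : hom P B) (p1' : hom P' A') (p2' : hom P' B') (e : hom A A')
    (f : hom B B') (m : hom P P') :
  is_product p1 p2 -> is_product p1' p2' ->
  is_product_map p1 p2 p1' p2' e f m ->
  regular_epi e -> regular_epi f -> regular_epi m.
Proof.
move=> hp hp' [m1 m2] he hf.
have [W [w1 [w2 hW]]] := product_exists A' B (proj1 hC).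
have [s [s1 s2]] := product_lift hW (e \o p1) p2.
have [t [t1 t2]] := product_lift hp' w1 (f \o w2).
have -> : m = t \o s.
  apply: (product_ext hp'); first by rewrite m1 compA t1 s1.
  by rewrite m2 compA t2 -compA s2.
apply: regular_epi_comp.
  exact: (product_map_regular_epi_l hp hW s1 s2 he).
exact: (product_map_regular_epi_l (product_sym hW) (product_sym hp') t2 t1 hf).
Qed.

(** [p1] is the pullback of [B -> 1] along [A -> 1], and [B -> 1] is a regular epimorphism because
    [X -> 1] factors through it. *)
Lemma product_projection_regular_epi (X A B : C) (p1 : hom X A) (p2 : hom X B) :
  global_support X -> is_product p1 p2 -> regular_epi p1.
Proof.
move=> [T [t [hT ht]]] hp; have [_ [_ hstab]] := hC.
have thin (S : C) (u v : hom S T) : u = v.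
  exact: (ex_unique_eq (hT S)).
have [a _] := hT A; have [b _] := hT B.
have hb : regular_epi b.
  by apply: (regular_epi_cancel (f := p2)); rewrite (thin _ (b \o p2) t).
apply: (hstab _ _ _ _ p1 p2 a b) hb; split; first exact: thin.
by move=> S u v _; apply: hp.
Qed.

(** The equation [E = E1 x E2] for the kernel congruences of [f], [q1] and [q2], read on generalized
    elements. *)
Definition same_kernel_as_product (X Y A B Q1 Q2 : C) (f : hom X Y)
    (p1 : hom X A) (p2 : hom X B) (q1 : hom A Q1) (q2 : hom B Q2) : Prop :=
  forall (T : C) (x y : hom T X),
    f \o x = f \o y <->
    q1 \o (p1 \o x) = q1 \o (p1 \o y) /\ q2 \o (p2 \o x) = q2 \o (p2 \o y).

(** The map [g] from [X] to [Q1 x Q2] is a regular epimorphism with the kernel of [f], so [Y] is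
    isomorphic to [Q1 x Q2] under [X]. *)
Lemma product_quotient (X Y A B Q1 Q2 : C) (f : hom X Y)
    (p1 : hom X A) (p2 : hom X B) (q1 : hom A Q1) (q2 : hom B Q2) :
  is_product p1 p2 -> regular_epi f -> regular_epi q1 -> regular_epi q2 ->
  same_kernel_as_product f p1 p2 q1 q2 ->
  exists (v1 : hom Y Q1) (v2 : hom Y Q2),
    is_product v1 v2 /\ q1 \o p1 = v1 \o f /\ q2 \o p2 = v2 \o f.
Proof.
move=> hp hf hq1 hq2 hker.
have [W [w1 [w2 hW]]] := product_exists Q1 Q2 (proj1 hC).
have [g [g1 g2]] := product_lift hW (q1 \o p1) (q2 \o p2).
have hg : regular_epi g by apply: (product_map_regular_epi hp hW _ hq1 hq2).
have [|w [hw ew]] := regular_epi_same_kernel_iso hf hg.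
  move=> T x y; split=> [/hker [e1 e2]|exy].
    by apply: (product_ext hW);
      rewrite ?(comp_reassoc g1) ?(comp_reassoc g2) -!compA.
  by apply/hker; rewrite !compA -g1 -g2 -!compA exy.
exists (w1 \o w), (w2 \o w); split; first exact: product_iso_apex.
by rewrite -!compA ew g1 g2.
Qed.

Lemma product_same_kernel (X Y A B Q1 Q2 : C) (f : hom X Y)
    (p1 : hom X A) (p2 : hom X B) (q1 : hom A Q1) (q2 : hom B Q2)
    (v1 : hom Y Q1) (v2 : hom Y Q2) :
  is_product v1 v2 -> q1 \o p1 = v1 \o f -> q2 \o p2 = v2 \o f ->
  same_kernel_as_product f p1 p2 q1 q2.
Proof.
move=> hv e1 e2 T x y; rewrite !compA e1 e2 -!compA.
by split=> [->|[h1 h2]] //; apply: (product_ext hv).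
Qed.

(* Equal elements of [B1] are lifted to [X] along [p1] with a common second
   component, which makes their images in [Y] equal. *)
Lemma product_square_pushout (X Y A B B1 B2 : C) (f : hom X Y)
    (p1 : hom X A) (p2 : hom X B) (g1 : hom A B1) (g2 : hom B B2)
    (q1 : hom Y B1) (q2 : hom Y B2) :
  global_support X -> is_product p1 p2 -> is_product q1 q2 ->
  regular_epi f -> regular_epi g1 ->
  g1 \o p1 = q1 \o f -> g2 \o p2 = q2 \o f ->
  M_pushout (@regular_epi C) p1 f g1 q1.
Proof.
move=> hX hp hq hf hg1 e1 e2.
have hp1 := product_projection_regular_epi hX hp.
split; last first.
  split=> //; apply: (regular_epi_cancel (f := f)).
  by rewrite -e1; apply: regular_epi_comp.
split=> // T a b eab.
have [|h eh] := @regular_epi_factor _ _ _ _ g1 a hg1.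
  move=> S x y exy.
  have [S' [r [s [hr es]]]] := regular_epi_local_lift x hp1.
  have [s' [es1 es2]] := product_lift hp (y \o r) (p2 \o s).
  apply: (regular_epi_epi hr); rewrite -!compA -es -es1 !(comp_reassoc2 eab).
  congr (_ \o _); apply: (product_ext hq).
    by rewrite -!(comp_reassoc2 e1) es es1 !compA exy.
  by rewrite -!(comp_reassoc2 e2) es2.
exists h; split.
  split=> //; apply: (regular_epi_epi hf).
  by rewrite -compA -e1 compA eh.
by move=> k [k1 _]; apply: (regular_epi_epi hg1); rewrite eh k1.
Qed.

End RegularCategory.

(** * Effective equivalence relations as kernels of regular epimorphisms *)

Section Congruences.
Context {C : category}.

Lemma product_relation_related (A X B : C) (pi1 : hom X A) (pi2 : hom X B)
    (E : relation A) (F : relation B) (G : relation X) :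
  is_product pi1 pi2 -> product_relation_eq pi1 pi2 E F G ->
  forall (T : C) (x y : hom T X), related G x y <->
    related E (pi1 \o x) (pi1 \o y) /\ related F (pi2 \o x) (pi2 \o y).
Proof.
move=> hpi [P [p1 [p2 [W [w1 [w2 [m [c [hP [_ [[m1 m2]]]]]]]]]]]].
move=> [[_ [c1 [c2 [c3 c4]]]] [i [[j [_ ij]] ei]]] T x y.
(* Along the isomorphism [i], the generic pair of [G] has as its four components those of the
   generic pairs of [E] and [F]. *)
have k1 : pi1 \o (sq1 G \o rel_mor G \o i) = sq1 E \o rel_mor E \o p1.
  by rewrite -!compA ei !compA c1 -!compA m1.
have k2 : pi2 \o (sq1 G \o rel_mor G \o i) = sq1 F \o rel_mor F \o p2.
  by rewrite -!compA ei !compA c2 -!compA m2.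
have k3 : pi1 \o (sq2 G \o rel_mor G \o i) = sq2 E \o rel_mor E \o p1.
  by rewrite -!compA ei !compA c3 -!compA m1.
have k4 : pi2 \o (sq2 G \o rel_mor G \o i) = sq2 F \o rel_mor F \o p2.
  by rewrite -!compA ei !compA c4 -!compA m2.
split=> [[h [<- <-]]|[[h1 [a1 a2]] [h2 [b1 b2]]]].
  split; [exists (p1 \o (j \o h))|exists (p2 \o (j \o h))]; split;
    rewrite ?(compA _ p1) ?(compA _ p2) -?k1 -?k2 -?k3 -?k4 -!compA;
    by rewrite (comp_reassoc ij) comp_idl.
have [h [e1 e2]] := product_lift hP h1 h2.
exists (i \o h); split; apply: (product_ext hpi); rewrite (compA _ i) compA.
- by rewrite k1 -compA e1.
- by rewrite k2 -compA e2.
- by rewrite k3 -compA e1.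
- by rewrite k4 -compA e2.
Qed.

(** Applying the hypothesis to generic pairs gives comparison maps both ways between [E_0 x F_0] and
    [G_0]. *)
Lemma related_product_relation (A X B : C) (pi1 : hom X A) (pi2 : hom X B)
    (E : relation A) (F : relation B) (G : relation X) :
  has_finite_limits C -> is_product pi1 pi2 ->
  (forall (T : C) (x y : hom T X), related G x y <->
    related E (pi1 \o x) (pi1 \o y) /\ related F (pi2 \o x) (pi2 \o y)) ->
  product_relation_eq pi1 pi2 E F G.
Proof.
move=> hlim hpi H.
have [P [p1 [p2 hP]]] := product_exists (rel_ob E) (rel_ob F) hlim.
have [W [w1 [w2 hW]]] := product_exists (rel_sq E) (rel_sq F) hlim.
have [m [m1 m2]] := product_lift hW (rel_mor E \o p1) (rel_mor F \o p2).
have [c hc] := canonical_iso_exists hpi (@sq_product _ _ E) (@sq_product _ _ F)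
  (@sq_product _ _ G) hW.
have [[d [dc cd]] [c1 [c2 [c3 c4]]]] := hc.
exists P, p1, p2, W, w1, w2, m, c; do 4!split=> //.
have hm : is_mono m.
  exact: (product_map_mono hP (conj m1 m2) (@rel_mono _ _ E) (@rel_mono _ _ F)).
have [i [i1 i2]] : related G (sq1 G \o c \o m) (sq2 G \o c \o m).
  apply/H; rewrite !compA c1 c2 c3 c4; split; [exists p1|exists p2];
    by rewrite -!compA ?m1 ?m2.
have ei : rel_mor G \o i = c \o m.
  by apply: (product_ext (@sq_product _ _ G)); rewrite !compA.
(* The generic pair of [G], given by the identity of [rel_ob G], has components in [E] and [F];
   pairing these yields a section [h] of the mono [i]. *)
have [[h1 [a1 a2]] [h2 [b1 b2]]] :=
  proj1 (H _ _ _) (ex_intro _ (idm (rel_ob G)) (conj eq_refl eq_refl)).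
have [h [e1 e2]] := product_lift hP h1 h2.
exists i; split=> //; apply: (mono_split_epi_iso (s := h)).
  move=> T u v euv; apply: hm.
  have : d \o (c \o m \o u) = d \o (c \o m \o v) by rewrite -ei -!compA euv.
  by rewrite -!compA !(comp_reassoc dc) !comp_idl.
apply: (@rel_mono _ _ G); rewrite compA ei comp_idr -compA.
move: a1 a2 b1 b2; rewrite !comp_idr => a1 a2 b1 b2.
apply: (product_ext (@sq_product _ _ G)); apply: (product_ext hpi);
  rewrite !compA ?c1 ?c2 ?c3 ?c4 -!compA ?(comp_reassoc m1) ?(comp_reassoc m2);
  by rewrite -compA ?e1 ?e2 compA ?a1 ?a2 ?b1 ?b2.
Qed.

Context (hC : regular_category C).

Lemma kernel_relation (A B : C) (f : hom A B) :
  exists E : relation A, effective_equivalence E /\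
    forall (T : C) (a b : hom T A), related E a b <-> f \o a = f \o b.
Proof.
have hlim := proj1 hC.
have [K [k1 [k2 hK]]] := pullback_exists f f hlim.
have [W [w1 [w2 hW]]] := product_exists A A hlim.
have [e [e1 e2]] := product_lift hW k1 k2.
have he : is_mono e.
  move=> T u v euv.
  apply: (ex_unique_eq (proj2 hK T (k1 \o v) (k2 \o v) _)); last by [].
    by rewrite !compA (proj1 hK).
  by rewrite -e1 -e2 -!compA euv.
have hrel (T : C) (a b : hom T A) :
    related (Relation hW he) a b <-> f \o a = f \o b.
  rewrite /related /= e1 e2; split=> [[h [<- <-]]|eab].
    by rewrite !compA (proj1 hK).
  by have [h [eh _]] := proj2 hK _ _ _ eab; exists h.
exists (Relation hW he); split=> //; split; last first.
  by exists B, f; rewrite /= e1 e2.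
move=> T; split; first by move=> a; apply/hrel.
split; first by move=> a b /hrel eab; apply/hrel.
by move=> a b c /hrel eab /hrel ebc; apply/hrel; rewrite eab.
Qed.

(** Effectiveness supplies some [s] with kernel pair [E]; its quotient part [q] in [s = m \o q] has
    the same kernel. *)
Lemma effective_equivalence_quotient (A : C) (E : relation A) :
  effective_equivalence E ->
  exists (Q : C) (q : hom A Q), regular_epi q /\
    forall (T : C) (a b : hom T A), related E a b <-> q \o a = q \o b.
Proof.
move=> [_ [B [s [es hs]]]].
have [Q [q [m [hq [em hker]]]]] := kernel_quotient hC s.
exists Q, q; split=> // T a b; split=> [[h [<- <-]]|eab].
  by apply: hker; rewrite compA es -compA.
have [|h [eh _]] := hs T a b; first by rewrite -em -!compA eab.
by exists h.
Qed.

(** Passing between relations and their quotients removes representatives of subobjects from the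
    condition: only [related] matters. *)
Lemma factorable_congruencesP (X : C) :
  factorable_congruences X <->
  forall (Y : C) (f : hom X Y), regular_epi f ->
  forall (A B : C) (p1 : hom X A) (p2 : hom X B), is_product p1 p2 ->
    exists (Q1 Q2 : C) (q1 : hom A Q1) (q2 : hom B Q2),
      regular_epi q1 /\ regular_epi q2 /\ same_kernel_as_product f p1 p2 q1 q2.
Proof.
split=> H.
  move=> Y f hf A B p1 p2 hp.
  have [E [hE relE]] := kernel_relation f.
  have [E1 [E2 [hE1 [hE2 hprod]]]] := H E hE _ _ _ _ hp.
  have [Q1 [q1 [hq1 rel1]]] := effective_equivalence_quotient hE1.
  have [Q2 [q2 [hq2 rel2]]] := effective_equivalence_quotient hE2.
  exists Q1, Q2, q1, q2; split=> //; split=> // T x y.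
  by rewrite -relE -rel1 -rel2; apply: product_relation_related.
move=> E hE A B p1 p2 hp.
have [Y [f [hf relE]]] := effective_equivalence_quotient hE.
have [Q1 [Q2 [q1 [q2 [_ [_ hker]]]]]] := H Y f hf _ _ _ _ hp.
have [E1 [hE1 rel1]] := kernel_relation q1.
have [E2 [hE2 rel2]] := kernel_relation q2.
exists E1, E2; split=> //; split=> //.
apply: (related_product_relation (proj1 hC)) => // T x y.
by rewrite relE rel1 rel2; apply: hker.
Qed.

End Congruences.

(** * Equivalence of factorable congruences and regular coextensivity *)

Theorem proposition7p2 (C : category) (hC : regular_category C) (X : C)
    (hX : global_support X) :
  factorable_congruences X <-> regularly_coextensive X.
Proof.
rewrite (factorable_congruencesP hC); split=> [H|[H1 H2]]; last first.
  (* From coextensivity to factorability: push [f] out along both projections. The bottom row is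
     then a product, whose legs are jointly monic, so the kernel of [f] splits. *)
  move=> Y f hf A B p1 p2 hp.
  have [|B1 [g1 [q1 po1]]] := H1 _ f hf _ p1; first by exists B, p2.
  have [|B2 [g2 [q2 po2]]] := H1 _ f hf _ p2.
    by exists A, p1; apply: product_sym.
  have [[e1 _] [hg1 _]] := po1; have [[e2 _] [hg2 _]] := po2.
  exists B1, B2, g1, g2; split=> //; split=> //.
  apply: (product_same_kernel _ e1 e2).
  by apply/(H2 _ _ _ _ _ _ _ _ _ g1 f g2 hp).
(* One decomposition of [f] serves twice: it supplies the pushouts along projections, and a product
   row with which any other pushouts are compared. *)
have quotient (Y : C) (f : hom X Y) (A B : C) (p1 : hom X A) (p2 : hom X B) :
    regular_epi f -> is_product p1 p2 ->
    exists (Q1 Q2 : C) (q1 : hom A Q1) (q2 : hom B Q2)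
      (v1 : hom Y Q1) (v2 : hom Y Q2),
      is_product v1 v2 /\ M_pushout (@regular_epi C) p1 f q1 v1 /\
      M_pushout (@regular_epi C) p2 f q2 v2.
  move=> hf hp; have [Q1 [Q2 [q1 [q2 [hq1 [hq2 hker]]]]]] := H _ _ hf _ _ _ _ hp.
  have [v1 [v2 [hv [e1 e2]]]] := product_quotient hC hp hf hq1 hq2 hker.
  exists Q1, Q2, q1, q2, v1, v2; split=> //; split.
    exact: (product_square_pushout hC hX hp hv hf hq1 e1 e2).
  have hv' := product_sym hv.
  exact: (product_square_pushout hC hX (product_sym hp) hv' hf hq2 e2 e1).
split=> [Y f hf A p1 [B [p2 hp]]|].
  have [Q1 [_ [q1 [_ [v1 [_ [_ [po _]]]]]]]] := quotient _ _ _ _ _ _ hf hp.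
  by exists Q1, q1, v1.
move=> A1 A2 p1 p2 B1 Y B2 q1 q2 g1 f g2 hp hg1 hf hg2 e1 e2.
split=> [hq|[[po1 _] [po2 _]]].
  split; first exact: (product_square_pushout hC hX hp hq hf hg1 e1 e2).
  have hq' := product_sym hq.
  exact: (product_square_pushout hC hX (product_sym hp) hq' hf hg2 e2 e1).
(* The given squares are isomorphic to the pushouts from [quotient], so [q1] and [q2] are the legs
   of a product followed by isomorphisms. *)
have [Q1 [Q2 [r1 [r2 [v1 [v2 [hv [[po1' _] [po2' _]]]]]]]]] :=
  quotient _ _ _ _ _ _ hf hp.
have [w1 [hw1 [_ <-]]] := pushout_unique po1' po1.
have [w2 [hw2 [_ <-]]] := pushout_unique po2' po2.
exact: product_iso_factors.
Qed.
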